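(* There exists a universal constant $K>0$ such that the following holds. Let $d\ge1$, $\theta\ge0$ and $T\ge K/\theta$. There is an algorithm which, given one copy each of unknown $d$-dimensional quantum states $\rho_1,\dots,\rho_T$ (i.e., given $\rho_1\otimes\cdots\otimes\rho_T$), distinguishes with probability at least $0.99$ the case $D_{\mathrm{HS}}^2(\rho_{\mathrm{avg}},\frac{I}{d})\le0.99\,\theta$ from the case $D_{\mathrm{HS}}^2(\rho_{\mathrm{avg}},\frac{I}{d})>\theta$, where $\rho_{\mathrm{avg}}=\frac1T\sum_{t=1}^T\rho_t$.
   Context: $D_{\mathrm{HS}}^2(\rho,\sigma)=\mathrm{Tr}[(\rho-\sigma)^2]$ is the squared Hilbert–Schmidt distance. The algorithm may apply any quantum measurement to $\rho_1\otimes\cdots\otimes\rho_T$ (chosen depending on $d,\theta,T$ only) and outputs accept/reject; ''distinguishes with probability at least $0.99$'' means it accepts with probability at least $0.99$ in the first case and rejects with probability at least $0.99$ in the second case. *)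

(* Defs.v *)
(* with Stdlib's real numbers R (a realType via Rstruct)
   and the complex numbers 'complex R' from mathcomp-real-closed. *)
From HB Require Import structures.
From mathcomp Require Import all_boot all_order all_algebra.
From mathcomp Require Import complex.
From mathcomp Require Import Rstruct.
From Stdlib Require Rdefinitions.

Set Implicit Arguments.
Unset Strict Implicit.
Unset Printing Implicit Defensive.

Import Order.TTheory GRing.Theory Num.Theory.
Local Open Scope ring_scope.

(* The complex numbers over Stdlib's reals. *)
Definition C := complex Rdefinitions.R.

(* Conjugate transpose. *)
Definition adjmx (m n : nat) (A : 'M[C]_(m, n)) : 'M[C]_(n, m) :=
  (map_mx (fun z : C => z^*) A)^T.

Definition hermitian (n : nat) (A : 'M[C]_n) : Prop := adjmx A = A.

(* Positive semidefinite: Hermitian with nonnegative quadratic form. *)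
Definition psd (n : nat) (A : 'M[C]_n) : Prop :=
  hermitian A /\ forall v : 'cV[C]_n, 0 <= (adjmx v *m A *m v) 0 0.

(* A d-dimensional quantum state (density matrix). *)
Definition density (n : nat) (rho : 'M[C]_n) : Prop :=
  psd rho /\ \tr rho = 1.

(* Squared Hilbert-Schmidt distance Tr[(rho - sigma)^2]. *)
Definition DHS2 (n : nat) (rho sigma : 'M[C]_n) : C :=
  \tr ((rho - sigma) *m (rho - sigma)).

(* Maximally mixed state I/d. *)
Definition maxmixed (d : nat) : 'M[C]_d := (d%:R)^-1 *: 1%:M.

(* Average state (1/T) sum_t rho_t. *)
Definition rho_avg (d T : nat) (rho : 'I_T -> 'M[C]_d) : 'M[C]_d :=
  (T%:R)^-1 *: \sum_(t < T) rho t.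

(* Basis index of (C^d)^{\otimes T}: functions 'I_T -> 'I_d,
   enumerated as ordinals of size NT d T = d^T. *)
Definition NT (d T : nat) : nat := #|{ffun 'I_T -> 'I_d}|.

(* The tensor product rho_1 (x) ... (x) rho_T, in the product basis. *)
Definition tensor_states (d T : nat) (rho : 'I_T -> 'M[C]_d)
  : 'M[C]_(NT d T) :=
  \matrix_(i, j) \prod_(t < T)
     rho t ((enum_val i : {ffun 'I_T -> 'I_d}) t)
           ((enum_val j : {ffun 'I_T -> 'I_d}) t).

(* Two-outcome measurement (accept effect M): 0 <= M <= I. *)
Definition accept_effect (n : nat) (M : 'M[C]_n) : Prop :=
  psd M /\ psd (1%:M - M).

(* Acceptance probability Tr[M sigma]. *)
Definition accept_prob (n : nat) (M sigma : 'M[C]_n) : C := \tr (M *m sigma).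

(* Main.v *)
Require Import Defs.
From HB Require Import structures.
From mathcomp Require Import all_boot all_order all_algebra.
From mathcomp Require Import complex.
From mathcomp Require Import Rstruct.
From mathcomp Require Import ring lra.
From Stdlib Require Rdefinitions.
Import Order.TTheory GRing.Theory Num.Theory.
Local Open Scope ring_scope.

(** Writing W for the sum of the swap operators S_st over ordered pairs s <> t, its mean in
    rho_1 (x) ... (x) rho_T is T^2 Tr(rho_avg^2) - sum_t Tr(rho_t^2), whose last term lies in [0, T].
    Accept on the spectral projector of W below T^2 (1/d + 0.995 theta) and apply
    Chebyshev's inequality. The variance is bounded through the Hoeffding decomposition
    W - mean = sum_(s <> t) Q_st + 2 sum_s G_s, where Q_st is centered at both sites s and t,
    and G_s is the centered local operator sum_(t <> s) rho_t at site s. Distinct terms are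
    uncorrelated, E[Q_st^2] <= E[S_st^2] = 1, and, since I/d only shifts G_s by a constant,
    E[G_s^2] <= Tr((T Delta - rho_s)^2 rho_s) with Delta = rho_avg - I/d. Altogether the
    variance is at most 10 T^2 + 8 T^3 Tr(Delta^2), with no dependence on d. *)

Set Implicit Arguments.
Unset Strict Implicit.
Unset Printing Implicit Defensive.

(** * Positive semidefinite matrices *)

Lemma adjmxK m n (A : 'M[C]_(m, n)) : adjmx (adjmx A) = A.
Proof. by apply/matrixP => i j; rewrite !mxE conjCK. Qed.

Lemma adjmxM m n p (A : 'M[C]_(m, n)) (B : 'M[C]_(n, p)) :
  adjmx (A *m B) = adjmx B *m adjmx A.
Proof. by rewrite /adjmx map_mxM trmx_mul. Qed.

Lemma adjmxD m n (A B : 'M[C]_(m, n)) : adjmx (A + B) = adjmx A + adjmx B.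
Proof. by apply/matrixP => i j; rewrite !mxE rmorphD. Qed.

Lemma adjmxB m n (A B : 'M[C]_(m, n)) : adjmx (A - B) = adjmx A - adjmx B.
Proof. by apply/matrixP => i j; rewrite !mxE rmorphB. Qed.

Lemma adjmxZ m n a (A : 'M[C]_(m, n)) : adjmx (a *: A) = a^* *: adjmx A.
Proof. by apply/matrixP => i j; rewrite !mxE rmorphM. Qed.

Lemma adjmx_sum m n (I : Type) (r : seq I) (P : pred I)
    (F : I -> 'M[C]_(m, n)) :
  adjmx (\sum_(i <- r | P i) F i) = \sum_(i <- r | P i) adjmx (F i).
Proof.
apply: (big_morph (@adjmx m n)) => [A B|]; first exact: adjmxD.
by apply/matrixP => i j; rewrite !mxE rmorph0.
Qed.

Lemma adjmx_scalar n (a : C) : adjmx (a%:M : 'M_n) = (a^*)%:M.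
Proof. by rewrite /adjmx map_scalar_mx tr_scalar_mx. Qed.

Lemma adjmx1 n : adjmx (1%:M : 'M_n) = 1%:M.
Proof. by rewrite adjmx_scalar rmorph1. Qed.

Lemma adjmx_delta m n (i : 'I_m) (j : 'I_n) :
  adjmx (delta_mx i j) = delta_mx j i.
Proof. by rewrite /adjmx map_delta_mx trmx_delta. Qed.

Lemma adjmx_mul_diag_ge0 m n (A : 'M[C]_(m, n)) i : 0 <= (A *m adjmx A) i i.
Proof.
by rewrite mxE; apply: sumr_ge0 => j _; rewrite !mxE mul_conjC_ge0.
Qed.

Lemma psd_gram m n (B : 'M[C]_(m, n)) : psd (adjmx B *m B).
Proof.
split=> [|v]; first by rewrite /Defs.hermitian adjmxM adjmxK.
rewrite mulmxA -mulmxA -adjmxM -{2}[B *m v]adjmxK.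
exact: adjmx_mul_diag_ge0.
Qed.

Lemma psd_congr_diag_ge0 m n (A : 'M[C]_n) (X : 'M[C]_(m, n)) i :
  psd A -> 0 <= (X *m A *m adjmx X) i i.
Proof.
move=> [_ /(_ (adjmx (row i X)))]; rewrite adjmxK => h.
suff -> : (X *m A *m adjmx X) i i = (row i X *m A *m adjmx (row i X)) 0 0 by [].
rewrite -row_mul !mxE; apply: eq_bigr => j _.
by rewrite !mxE.
Qed.

Lemma mxtrace_gram_psd_ge0 m n (X : 'M[C]_(m, n)) (A : 'M[C]_n) :
  psd A -> 0 <= \tr (adjmx X *m X *m A).
Proof.
move=> pA; rewrite -mulmxA mxtrace_mulC.
by apply: sumr_ge0 => i _; apply: psd_congr_diag_ge0.
Qed.

(** This is the spectral theorem for normal matrices, with the eigenvalues stored as real numbers so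
    that functions on the reals can be applied to them. *)
Lemma hermitian_spectral n (A : 'M[C]_n) : Defs.hermitian A ->
  exists (U : 'M[C]_n) (x : 'rV[Rdefinitions.R]_n),
    [/\ U *m adjmx U = 1%:M, adjmx U *m U = 1%:M
      & A = adjmx U *m diag_mx (map_mx (real_complex _) x) *m U].
Proof.
move=> hA.
have hA' : A \is hermsymmx.
  by apply/is_hermitianmxP; rewrite expr0 scale1r -map_trmx; exact: esym.
have U1 := spectral_unitarymx A.
have adjU : adjmx (spectralmx A) = invmx (spectralmx A).
  by rewrite invmx_unitary // /adjmx map_trmx.
exists (spectralmx A), (map_mx (@complex.Re _) (spectral_diag A)); split.
- by rewrite adjU mulmxV // spectral_unit.
- by rewrite adjU mulVmx // spectral_unit.
rewrite adjU.
have /hermitian_normalmx/orthomx_spectralP {1}-> := hA'.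
congr (_ *m diag_mx _ *m _).
have /mxOverP hr := hermitian_spectral_diag_real hA'.
by apply/matrixP => i j; rewrite !mxE RRe_real.
Qed.

Lemma diag_mx_real_gram n (y : 'rV[Rdefinitions.R]_n) :
  (forall i, 0 <= y 0 i) ->
  exists D : 'M[C]_n, diag_mx (map_mx (real_complex _) y) = adjmx D *m D.
Proof.
move=> y0; exists (diag_mx (map_mx (fun r => (Num.sqrt r)%:C%C) y)).
rewrite /adjmx map_diag_mx tr_diag_mx mulmx_diag; congr diag_mx.
apply/rowP => i; rewrite !mxE.
transitivity (((Num.sqrt (y 0 i))%:C * (Num.sqrt (y 0 i))%:C)%C : C).
  by rewrite -rmorphM -expr2 sqr_sqrtr.
by congr (_ * _); apply/esym/conjc_real.
Qed.

Lemma psd_unitary_diag n (U : 'M[C]_n) (y : 'rV[Rdefinitions.R]_n) :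
  (forall i, 0 <= y 0 i) ->
  psd (adjmx U *m diag_mx (map_mx (real_complex _) y) *m U).
Proof.
move=> /diag_mx_real_gram[D ->].
by rewrite -!mulmxA mulmxA -adjmxM; apply: psd_gram.
Qed.

Lemma psd_spectral n (A : 'M[C]_n) : psd A ->
  exists (U : 'M[C]_n) (x : 'rV[Rdefinitions.R]_n),
    [/\ U *m adjmx U = 1%:M, adjmx U *m U = 1%:M,
        A = adjmx U *m diag_mx (map_mx (real_complex _) x) *m U
      & forall i, 0 <= x 0 i].
Proof.
move=> pA; have [U [x [U1 U2 eA]]] := hermitian_spectral pA.1.
exists U, x; split=> // i.
have := psd_congr_diag_ge0 U i pA; rewrite {1}eA.
rewrite !mulmxA U1 mul1mx -mulmxA U1 mulmx1 !mxE eqxx mulr1n.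
by rewrite -(rmorph0 (real_complex _)) lecR.
Qed.

Lemma psd_factor n (A : 'M[C]_n) : psd A -> exists B : 'M[C]_n, A = adjmx B *m B.
Proof.
move=> /psd_spectral[U [x [_ _ -> /diag_mx_real_gram[D ->]]]].
by exists (D *m U); rewrite adjmxM !mulmxA.
Qed.

Lemma mxtrace_psd_mul_ge0 n (A B : 'M[C]_n) :
  psd A -> psd B -> 0 <= \tr (A *m B).
Proof. by move=> /psd_factor[X ->]; apply: mxtrace_gram_psd_ge0. Qed.

(** The eigenvalues are nonnegative and sum to the trace 1, so each is at most 1. *)
Lemma density_le1 n (A : 'M[C]_n) : density A -> psd (1%:M - A).
Proof.
move=> [pA trA]; have [U [x [U1 U2 eA x0]]] := psd_spectral pA.
have sx : \sum_i x 0 i = 1.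
  apply: (@complexI Rdefinitions.R); rewrite rmorph1 -trA eA.
  rewrite mxtrace_mulC mulmxA U1 mul1mx mxtrace_diag rmorph_sum.
  by apply: eq_bigr => i _; rewrite !mxE.
have x1 i : x 0 i <= 1.
  by rewrite -sx (bigD1 i) //= lerDl; apply: sumr_ge0.
suff -> : 1%:M - A =
    adjmx U *m diag_mx (map_mx (real_complex _) (const_mx 1 - x)) *m U.
  by apply: psd_unitary_diag => i; rewrite !mxE subr_ge0.
have -> : diag_mx (map_mx (real_complex _) (const_mx 1 - x))
    = 1%:M - diag_mx (map_mx (real_complex _) x) :> 'M[C]_n.
  apply/matrixP => i j; rewrite !mxE.
  by case: (i == j); rewrite ?mulr1n ?mulr0n ?subr0 // rmorphB.
by rewrite mulmxBr mulmxBl mulmx1 U2 -eA.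
Qed.

Lemma mxtrace_gram_density_le m n (X : 'M[C]_(m, n)) (A : 'M[C]_n) :
  density A -> \tr (adjmx X *m X *m A) <= \tr (adjmx X *m X).
Proof.
move=> /density_le1/(mxtrace_gram_psd_ge0 X).
by rewrite mulmxBr mulmx1 raddfB /= subr_ge0.
Qed.

(** * Spectral threshold measurements *)

(** [M] projects onto the eigenvectors of [X] with eigenvalue at most [tau]. Measuring in the
    eigenbasis turns [sigma] into a classical distribution, to which Chebyshev's inequality applies.
    [M] is fixed before [sigma], [m], [delta] and [v], so one measurement serves all unknown
    states. *)
Lemma threshold_test n (X : 'M[C]_n) (tau : Rdefinitions.R) :
  Defs.hermitian X ->
  exists M : 'M[C]_n, accept_effect M /\
    forall sigma, density sigma ->
    forall m delta v : Rdefinitions.R, 0 < delta ->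
      \tr ((X - (m%:C)%C%:M) *m (X - (m%:C)%C%:M) *m sigma) <= (v%:C)%C ->
      (m + delta <= tau ->
         ((1 - v / delta ^+ 2)%:C)%C <= accept_prob M sigma) /\
      (tau + delta <= m ->
         accept_prob M sigma <= ((v / delta ^+ 2)%:C)%C).
Proof.
move=> /hermitian_spectral[U [x [U1 U2 eX]]].
pose fn (g : Rdefinitions.R -> Rdefinitions.R) : 'M[C]_n :=
  adjmx U *m diag_mx (map_mx (real_complex _) (map_mx g x)) *m U.
pose ind (r : Rdefinitions.R) : Rdefinitions.R := (r <= tau)%R%:R.
have fnB1 : 1%:M - fn ind = fn (fun r => 1 - ind r).
  rewrite /fn -[1%:M in LHS]U2 -{1}(mulmx1 (adjmx U)) -mulmxBl -mulmxBr.
  congr (_ *m _ *m _); apply/matrixP => i j; rewrite !mxE.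
  by case: (i == j); rewrite ?mulr1n ?mulr0n ?subr0 // rmorphB.
exists (fn ind); split.
  split; last rewrite fnB1; apply: psd_unitary_diag => i; rewrite !mxE.
    exact: ler0n.
  by rewrite subr_ge0 lern1 leq_b1.
move=> sigma [psig trsig] m delta v d0.
(* [q i] is the probability of obtaining the [i]-th eigenvector as outcome. *)
pose q i := complex.Re ((U *m sigma *m adjmx U) i i).
have q0 i : 0 <= q i.
  by have := psd_congr_diag_ge0 U i psig; rewrite lecE /= => /andP[].
have qE i : ((q i)%:C)%C = (U *m sigma *m adjmx U) i i.
  by rewrite /q RRe_real // ger0_real // psd_congr_diag_ge0.
have trfn g : \tr (fn g *m sigma) = ((\sum_i g (x 0 i) * q i)%:C)%C.
  rewrite /fn -!mulmxA mxtrace_mulC -mulmxA.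
  rewrite rmorph_sum; apply: eq_bigr => i _.
  by rewrite mul_diag_mx mxE !mxE rmorphM /= qE !mxE.
have sq : \sum_i q i = 1.
  apply: (@complexI Rdefinitions.R); rewrite rmorph1 -trsig rmorph_sum /=.
  rewrite -[sigma in RHS]mul1mx -U2 -mulmxA mxtrace_mulC.
  by apply: eq_bigr => i _; rewrite qE.
have -> : (X - (m%:C)%C%:M) *m (X - (m%:C)%C%:M) = fn (fun r => (r - m) ^+ 2).
  have -> : X - (m%:C)%C%:M = fn (fun r => r - m).
    have -> : (m%:C)%C%:M = adjmx U *m (m%:C)%C%:M *m U.
      by rewrite scalar_mxC -mulmxA U2 mulmx1.
    rewrite eX -mulmxBl -mulmxBr; congr (_ *m _ *m _).
    apply/matrixP => i j; rewrite !mxE.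
    by case: (i == j); rewrite ?mulr1n ?mulr0n ?subr0 // rmorphB.
  rewrite /fn !mulmxA; congr (_ *m _).
  rewrite -!mulmxA; congr (_ *m _); rewrite (mulmxA U) U1 mul1mx mulmx_diag.
  congr diag_mx; apply/rowP => i; rewrite !mxE -rmorphM.
  by rewrite expr2.
rewrite trfn lecR => hv.
(* Chebyshev: [g] will be the indicator of the wrong answer, which forces the eigenvalue to be at
   distance at least [delta] from [m]. *)
have cheb (g : Rdefinitions.R -> Rdefinitions.R) :
    (forall r, g r <= (r - m) ^+ 2 / delta ^+ 2) ->
    \sum_i g (x 0 i) * q i <= v / delta ^+ 2.
  move=> hg; apply: le_trans (_ : (\sum_i (x 0 i - m) ^+ 2 * q i) / delta ^+ 2 <= _).
    rewrite mulr_suml; apply: ler_sum => i _.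
    by rewrite mulrAC; apply: ler_wpM2r.
  by rewrite ler_wpM2r // invr_ge0 exprn_ge0 // ltW.
have d2 : 0 < delta ^+ 2 by rewrite exprn_gt0.
split=> hm.
  have -> : accept_prob (fn ind) sigma
      = ((1 - \sum_i (1 - ind (x 0 i)) * q i)%:C)%C.
    rewrite /accept_prob trfn; congr (_%:C)%C.
    under [in RHS]eq_bigr do rewrite mulrBl mul1r.
    by rewrite sumrB sq opprB addrC subrK.
  rewrite lecR lerD2l lerN2; apply: (cheb (fun r => 1 - ind r)) => r.
  rewrite /ind; case: (leP r tau) => hr /=; rewrite ?mulr1n ?mulr0n ?subrr ?subr0.
    by rewrite divr_ge0 ?sqr_ge0 // ltW.
  rewrite ler_pdivlMr // mul1r lerXn2r ?nnegrE //; lra.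
rewrite /accept_prob trfn lecR; apply: cheb => r.
rewrite /ind; case: (leP r tau) => hr /=; rewrite ?mulr1n ?mulr0n.
  rewrite ler_pdivlMr // mul1r -[(r - m) ^+ 2]sqrrN lerXn2r ?nnegrE //; lra.
by rewrite divr_ge0 ?sqr_ge0 // ltW.
Qed.

(** * Tensor products and local operators *)

Section Tensor.
Variables (d T : nat).
Implicit Types (A B : 'I_T -> 'M[C]_d).

(** Distributivity over multi-indices; products and traces of tensor products become sitewise
    through it. *)
Lemma big_enum_val_prod (F : 'I_T -> 'I_d -> C) :
  \sum_(k < NT d T) \prod_(t < T) F t ((enum_val k : {ffun 'I_T -> 'I_d}) t)
  = \prod_(t < T) \sum_(j < d) F t j.
Proof.
rewrite bigA_distr_bigA /= /NT.
rewrite (reindex (@enum_val {ffun 'I_T -> 'I_d} predT)) //=.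
by exists enum_rank => k _; [exact: enum_valK | exact: enum_rankK].
Qed.

Lemma eq_tensor A B : A =1 B -> tensor_states A = tensor_states B.
Proof.
by move=> e; apply/matrixP => i j; rewrite !mxE; apply: eq_bigr => t _; rewrite e.
Qed.

Lemma mul_tensor A B :
  tensor_states A *m tensor_states B = tensor_states (fun t => A t *m B t).
Proof.
apply/matrixP => i j; rewrite !mxE.
under [in RHS]eq_bigr do rewrite mxE.
rewrite -big_enum_val_prod; apply: eq_bigr => k _.
by rewrite !mxE -big_split.
Qed.

Lemma mxtrace_tensor A : \tr (tensor_states A) = \prod_t \tr (A t).
Proof.
rewrite /mxtrace -big_enum_val_prod; apply: eq_bigr => k _.
by rewrite mxE.
Qed.

Lemma adjmx_tensor A :
  adjmx (tensor_states A) = tensor_states (fun t => adjmx (A t)).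
Proof.
apply/matrixP => i j; rewrite !mxE rmorph_prod; apply: eq_bigr => t _.
by rewrite !mxE.
Qed.

Lemma tensor1 : tensor_states (fun _ : 'I_T => 1%:M : 'M[C]_d) = 1%:M.
Proof.
apply/matrixP => i j; rewrite !mxE.
have [->|ne] := eqVneq i j.
  by rewrite big1 // => t _; rewrite mxE eqxx.
have : enum_val i != enum_val j :> {ffun 'I_T -> 'I_d}.
  by apply: contra ne => /eqP/enum_val_inj->.
case: (pickP (fun t => (enum_val i : {ffun 'I_T -> 'I_d}) t
                       != (enum_val j : {ffun 'I_T -> 'I_d}) t)) => [t ht _|h].
  by rewrite (bigD1 t) //= mxE (negbTE ht) mul0r.
by case/eqP; apply/ffunP => t; apply/eqP; move/negbFE: (h t).
Qed.

Lemma psd_tensor A : (forall t, psd (A t)) -> psd (tensor_states A).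
Proof.
move=> pA.
have [B eB] : exists B : {ffun 'I_T -> 'M[C]_d}, forall t, A t = adjmx (B t) *m B t.
  have hB t : exists X : 'M[C]_d, A t == adjmx X *m X.
    by have [X ->] := psd_factor (pA t); exists X.
  (* The factorization was stated with boolean equality so that [xchoose] selects one factor per
     site. *)
  by exists [ffun t => xchoose (hB t)] => t; rewrite ffunE; apply/eqP/(xchooseP (hB t)).
rewrite (eq_tensor eB) -mul_tensor -adjmx_tensor; exact: psd_gram.
Qed.

Lemma density_tensor A : (forall t, density (A t)) -> density (tensor_states A).
Proof.
move=> dA; split; first by apply: psd_tensor => t; have [] := dA t.
by rewrite mxtrace_tensor big1 // => t _; have [] := dA t.
Qed.

End Tensor.

Definition site d T (s : 'I_T) (X : 'M[C]_d) (t : 'I_T) : 'M[C]_d :=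
  if t == s then X else 1%:M.

(* Locked: comparing [loc s X] with [loc t Y] by unfolding is intractable. *)
HB.lock Definition loc d T (s : 'I_T) (X : 'M[C]_d) : 'M[C]_(NT d T) :=
  tensor_states (site s X).
Arguments loc {d T} s X.

Section Local.
Variables (d T : nat).
Implicit Types (s t : 'I_T) (X Y : 'M[C]_d).

Lemma site_same s X : site s X s = X.
Proof. by rewrite /site eqxx. Qed.

Lemma site_diff s t X : t != s -> site s X t = 1%:M.
Proof. by rewrite /site => /negbTE->. Qed.

Lemma locE s X i j : loc s X i j =
  X ((enum_val i : {ffun 'I_T -> 'I_d}) s) ((enum_val j : {ffun 'I_T -> 'I_d}) s)
  * \prod_(t < T | t != s) (1%:M : 'M[C]_d)
      ((enum_val i : {ffun 'I_T -> 'I_d}) t) ((enum_val j : {ffun 'I_T -> 'I_d}) t).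
Proof.
rewrite loc.unlock mxE (bigD1 s) //= site_same; congr (_ * _).
by apply: eq_bigr => t ts; rewrite site_diff.
Qed.

Lemma loc_linear s : linear (@loc d T s).
Proof.
move=> a X Y; apply/matrixP => i j; rewrite [RHS]mxE [X in _ = X + _]mxE !locE.
by rewrite [in LHS]mxE [in LHS]mxE mulrDl mulrA.
Qed.

HB.instance Definition _ s :=
  GRing.isLinear.Build C 'M[C]_d 'M[C]_(NT d T) _ (@loc d T s) (loc_linear s).

Lemma loc1 s : loc s (1%:M : 'M[C]_d) = 1%:M.
Proof.
by rewrite loc.unlock -tensor1; apply: eq_tensor => t; rewrite /site if_same.
Qed.

Lemma loc_scalar s a : loc s (a%:M : 'M[C]_d) = a%:M.
Proof. by rewrite -scalemx1 linearZ /= loc1 scalemx1. Qed.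

(** Sites may coincide: in every case the product remains a tensor product, so its expectation in a
    product state factors over the sites. *)
Lemma loc_mul2 r s X Y :
  loc r X *m loc s Y = tensor_states (fun t => site r X t *m site s Y t).
Proof. by rewrite loc.unlock mul_tensor. Qed.

Lemma loc_mul3 q r s X Y Z :
  loc q X *m (loc r Y *m loc s Z)
  = tensor_states (fun t => site q X t *m (site r Y t *m site s Z t)).
Proof. by rewrite loc_mul2 loc.unlock mul_tensor. Qed.

Lemma loc_mul4 p q r s W X Y Z :
  loc p W *m (loc q X *m (loc r Y *m loc s Z))
  = tensor_states
      (fun t => site p W t *m (site q X t *m (site r Y t *m site s Z t))).
Proof. by rewrite loc_mul3 loc.unlock mul_tensor. Qed.

Lemma locM s X Y : loc s X *m loc s Y = loc s (X *m Y).
Proof.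
rewrite loc_mul2 loc.unlock; apply: eq_tensor => t.
by rewrite /site; case: eqP; rewrite ?mulmx1.
Qed.

Lemma locC s t X Y : s != t -> loc s X *m loc t Y = loc t Y *m loc s X.
Proof.
move=> st; rewrite !loc_mul2; apply: eq_tensor => r; rewrite /site.
by case: (eqVneq r s) => [->|_]; rewrite ?(negbTE st) ?mul1mx ?mulmx1.
Qed.

Lemma adjmx_loc s X : adjmx (loc s X) = loc s (adjmx X).
Proof.
rewrite loc.unlock adjmx_tensor; apply: eq_tensor => t.
by rewrite /site; case: eqP; rewrite ?adjmx1.
Qed.

End Local.

(** * Expectations and second moments *)

Definition ev n (sigma X : 'M[C]_n) : C := \tr (X *m sigma).

Lemma ev_scalar n (sigma : 'M[C]_n) : scalar (ev sigma).
Proof.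
by move=> a X Y; rewrite /ev mulmxDl -scalemxAl mxtraceD mxtraceZ.
Qed.

HB.instance Definition _ n (sigma : 'M[C]_n) :=
  GRing.isLinear.Build C 'M[C]_n C _ (ev sigma) (ev_scalar sigma).

Lemma ev_sqr_ge0 n (sigma X : 'M[C]_n) :
  psd sigma -> Defs.hermitian X -> 0 <= ev sigma (X *m X).
Proof. by move=> ps hX; rewrite -{1}hX; apply: mxtrace_gram_psd_ge0. Qed.

Lemma ev_real n (sigma X : 'M[C]_n) :
  Defs.hermitian sigma -> Defs.hermitian X -> (ev sigma X)^* = ev sigma X.
Proof.
move=> hs hX; rewrite /ev [RHS]mxtrace_mulC -[in RHS]hs -[in RHS]hX -adjmxM.
by rewrite /mxtrace rmorph_sum; apply: eq_bigr => i _; rewrite [RHS]mxE [RHS]mxE.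
Qed.

Lemma hermitianD n (X Y : 'M[C]_n) :
  Defs.hermitian X -> Defs.hermitian Y -> Defs.hermitian (X + Y).
Proof. by move=> hX hY; rewrite /Defs.hermitian adjmxD hX hY. Qed.

Lemma hermitian_scalar n (a : C) :
  a \is Num.real -> Defs.hermitian (a%:M : 'M[C]_n).
Proof. by move=> ar; rewrite /Defs.hermitian adjmx_scalar (CrealP ar). Qed.

Lemma ev_sqrD n (sigma X Y : 'M[C]_n) :
  ev sigma ((X + Y) *m (X + Y)) = ev sigma (X *m X) + ev sigma (X *m Y)
                                + (ev sigma (Y *m X) + ev sigma (Y *m Y)).
Proof. by rewrite mulmxDl 2!mulmxDr 3!raddfD. Qed.

Lemma ev_mulr_sum_eq0 n (sigma Q X Y : 'M[C]_n) (c : C) :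
  ev sigma (Q *m X) = 0 -> ev sigma (Q *m Y) = 0 -> ev sigma Q = 0 ->
  ev sigma (Q *m (X + Y + c%:M)) = 0.
Proof.
move=> hX hY hQ; rewrite 2!mulmxDr mul_mx_scalar 2!raddfD /= linearZ /=.
by rewrite hX hY hQ mulr0 !addr0.
Qed.

Lemma ev_mull_sum_eq0 n (sigma Q X Y : 'M[C]_n) (c : C) :
  ev sigma (X *m Q) = 0 -> ev sigma (Y *m Q) = 0 -> ev sigma Q = 0 ->
  ev sigma ((X + Y + c%:M) *m Q) = 0.
Proof.
move=> hX hY hQ; rewrite 2!mulmxDl mul_scalar_mx 2!raddfD /= linearZ /=.
by rewrite hX hY hQ mulr0 !addr0.
Qed.

(** Pythagoras for the second moment: the cross terms vanish and [Y] contributes a nonnegative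
    square. *)
Lemma ev_sqrD_ge n (sigma X Y : 'M[C]_n) :
  psd sigma -> Defs.hermitian Y ->
  ev sigma (X *m Y) = 0 -> ev sigma (Y *m X) = 0 ->
  ev sigma (X *m X) <= ev sigma ((X + Y) *m (X + Y)).
Proof.
by move=> ps hY XY YX; rewrite ev_sqrD XY YX addr0 add0r lerDl ev_sqr_ge0.
Qed.

Lemma evZ n (sigma X : 'M[C]_n) a : ev sigma (a *: X) = a * ev sigma X.
Proof. exact: linearZ. Qed.

Lemma ev_mul_sum n (sigma : 'M[C]_n) (I J : finType) (P : pred I) (Q : pred J)
    (F : I -> 'M[C]_n) (G : J -> 'M[C]_n) :
  ev sigma ((\sum_(i | P i) F i) *m (\sum_(j | Q j) G j))
  = \sum_(i | P i) \sum_(j | Q j) ev sigma (F i *m G j).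
Proof.
rewrite mulmx_suml linear_sum; apply: eq_bigr => i _ /=.
by rewrite mulmx_sumr linear_sum.
Qed.

Lemma ev_mul_sum_eq0 n (sigma : 'M[C]_n) (I J : finType) (P : pred I) (Q : pred J)
    (F : I -> 'M[C]_n) (G : J -> 'M[C]_n) :
  (forall i j, P i -> Q j -> ev sigma (F i *m G j) = 0) ->
  ev sigma ((\sum_(i | P i) F i) *m (\sum_(j | Q j) G j)) = 0.
Proof.
move=> h; rewrite ev_mul_sum big1 // => i Pi.
by rewrite big1 // => j Qj; apply: h.
Qed.

Lemma ev_sqr_sum_orthogonal n (sigma : 'M[C]_n) (I : finType) (F : I -> 'M[C]_n) :
  (forall i j, i != j -> ev sigma (F i *m F j) = 0) ->
  ev sigma ((\sum_i F i) *m (\sum_i F i)) = \sum_i ev sigma (F i *m F i).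
Proof.
move=> h; rewrite ev_mul_sum; apply: eq_bigr => i _.
by rewrite (bigD1 i) //= big1 ?addr0 // => j ji; rewrite h // eq_sym.
Qed.

(** Each ordered pair correlates only with itself and with its reversal, so each contributes at most
    2, and there are at most [T ^ 2] ordered pairs. *)
Lemma ev_sqr_sum_pairs_le n (sigma : 'M[C]_n) T (F : 'I_T -> 'I_T -> 'M[C]_n) :
  (forall s t, s != t -> F t s = F s t) ->
  (forall s t, s != t -> ev sigma (F s t *m F s t) <= 1) ->
  (forall s t s' t', s != t -> s' != t' -> (s', t') != (s, t) ->
     (s', t') != (t, s) -> ev sigma (F s t *m F s' t') = 0) ->
  ev sigma ((\sum_(p : 'I_T * 'I_T | p.1 != p.2) F p.1 p.2)
            *m (\sum_(p : 'I_T * 'I_T | p.1 != p.2) F p.1 p.2))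
  <= 2%:R * T%:R ^+ 2.
Proof.
move=> FC F1 F0.
apply: (@le_trans _ _ (\sum_(p : 'I_T * 'I_T) 2%:R)); last first.
  by rewrite sumr_const card_prod card_ord -[_ *+ (_ * _)]mulr_natr natrM expr2.
rewrite ev_mul_sum [leLHS]big_mkcond /=; apply: ler_sum => -[s t] _ /=.
case: ifP => // st; rewrite (bigD1 (s, t)) //= (bigD1 (t, s)) /=; last first.
  by rewrite eq_sym st xpair_eqE eq_sym (negbTE st).
rewrite big1 => [|[a b] /= /andP[/andP[ab h1] h2]]; last exact: F0.
by rewrite addr0 (FC _ _ st) -[2%:R]/(1 + 1); apply: lerD; apply: F1.
Qed.

Lemma ev_sqrZ n (sigma X : 'M[C]_n) a :
  ev sigma ((a *: X) *m (a *: X)) = a ^+ 2 * ev sigma (X *m X).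
Proof. by rewrite -scalemxAl -scalemxAr scalerA evZ. Qed.

Lemma ev_sqrD_orthogonal n (sigma X Y : 'M[C]_n) (a : C) :
  ev sigma (X *m Y) = 0 -> ev sigma (Y *m X) = 0 ->
  ev sigma ((X + a *: Y) *m (X + a *: Y))
  = ev sigma (X *m X) + a ^+ 2 * ev sigma (Y *m Y).
Proof.
move=> XY YX; rewrite ev_sqrD ev_sqrZ -scalemxAr -scalemxAl !evZ XY YX.
by rewrite mulr0 addr0 add0r.
Qed.

Lemma ev_sqr_centered n (sigma Y : 'M[C]_n) : ev sigma 1%:M = 1 ->
  ev sigma ((Y - (ev sigma Y)%:M) *m (Y - (ev sigma Y)%:M))
  = ev sigma (Y *m Y) - ev sigma Y ^+ 2.
Proof.
move=> e1; move ey : (ev sigma Y) => y.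
rewrite mulmxBl 2!mulmxBr -scalar_mxM mul_scalar_mx mul_mx_scalar.
by rewrite 3!(raddfB (ev sigma)) /= -scalemx1 !evZ e1 ey; ring.
Qed.

(** * The pairwise swap statistic *)

Section Swap.
Variables (d T : nat).
Implicit Types (s t : 'I_T) (X Y : 'M[C]_d).

(** For distinct sites this is the operator exchanging the tensor factors [s] and [t], written in
    matrix units as the sum of E_ij (x) E_ji. *)
Definition swap s t : 'M[C]_(NT d T) :=
  \sum_(p : 'I_d * 'I_d)
    loc s (delta_mx p.1 p.2) *m loc t (delta_mx p.2 p.1).

Lemma reindex_swap (V : nmodType) (P : pred ('I_d * 'I_d)) (F : 'I_d * 'I_d -> V) :
  \sum_(p | P p) F p = \sum_(p | P (p.2, p.1)) F (p.2, p.1).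
Proof.
rewrite (reindex (fun p => (p.2, p.1))) //.
by exists (fun p => (p.2, p.1)) => [[]|[]].
Qed.

Lemma locM4 s t X Y X' Y' : s != t ->
  loc s X *m loc t Y *m (loc s X' *m loc t Y')
  = loc s (X *m X') *m loc t (Y *m Y').
Proof.
move=> st; rewrite -!locM -!mulmxA; congr (_ *m _).
by rewrite !mulmxA [loc t Y *m _]locC // eq_sym.
Qed.

Lemma adjmx_swap s t : s != t -> adjmx (swap s t) = swap s t.
Proof.
move=> st; rewrite adjmx_sum [RHS]reindex_swap; apply: eq_bigr => p _ /=.
by rewrite adjmxM !adjmx_loc !adjmx_delta locC // eq_sym.
Qed.

Lemma swap_sqr s t : s != t -> swap s t *m swap s t = 1%:M.
Proof.
move=> st; rewrite mulmx_suml.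
transitivity (\sum_(p : 'I_d * 'I_d)
   loc s (delta_mx p.1 p.1) *m loc t (delta_mx p.2 p.2)); last first.
  rewrite -(pair_bigA _ (fun i j => loc s (delta_mx i i) *m loc t (delta_mx j j))) /=.
  under eq_bigr do rewrite -mulmx_sumr -linear_sum /= -mx1_sum_delta loc1 mulmx1.
  by rewrite -linear_sum /= -mx1_sum_delta loc1.
(* Among the products of matrix units only the one with the reversed index pair survives; the
   survivors form a resolution of the identity. *)
apply: eq_bigr => p _; rewrite mulmx_sumr (bigD1 (p.2, p.1)) //= locM4 //.
rewrite !mul_delta_mx big1 ?addr0 // => -[i j] ne; rewrite locM4 //=.
rewrite !mul_delta_mx_cond.
move: ne; rewrite xpair_eqE negb_and ![_ == p.1]eq_sym ![_ == p.2]eq_sym.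
by case/orP => /negbTE ->; rewrite mulr0n linear0 ?mulmx0 ?mul0mx.
Qed.

(** * Hoeffding decomposition of the swap operators *)

Section Moments.
Variable rho : 'I_T -> 'M[C]_d.
Hypothesis rho_density : forall t, density (rho t).

Local Notation E := (ev (tensor_states rho)).

Lemma ev_tensor (F : 'I_T -> 'M[C]_d) :
  E (tensor_states F) = \prod_t ev (rho t) (F t).
Proof. by rewrite /ev mul_tensor mxtrace_tensor. Qed.

(** One centered site kills the whole product; all orthogonality relations below rest on this. *)
Lemma ev_tensor_eq0 (F : 'I_T -> 'M[C]_d) s :
  ev (rho s) (F s) = 0 -> E (tensor_states F) = 0.
Proof. by move=> F0; rewrite ev_tensor (bigD1 s) //= F0 mul0r. Qed.

Lemma ev1 t : ev (rho t) 1%:M = 1.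
Proof. by rewrite /ev mul1mx; have [] := rho_density t. Qed.

Lemma ev_scalar_mx t a : ev (rho t) a%:M = a.
Proof. by rewrite -scalemx1 linearZ /= ev1 mulr1. Qed.

Lemma ev_loc s X : E (loc s X) = ev (rho s) X.
Proof.
rewrite loc.unlock ev_tensor (bigD1 s) //= site_same big1 ?mulr1 // => t ts.
by rewrite site_diff // ev1.
Qed.

Definition cen s X : 'M[C]_d := X - (ev (rho s) X)%:M.

Lemma cen_linear s : linear (cen s).
Proof.
move=> a X Y; rewrite /cen linearP /= raddfD /= -scale_scalar_mx scalerBr.
by rewrite opprD addrACA.
Qed.

HB.instance Definition _ s :=
  GRing.isLinear.Build C 'M[C]_d 'M[C]_d _ (cen s) (cen_linear s).

Lemma ev_cen s X : ev (rho s) (cen s X) = 0.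
Proof. by rewrite raddfB /= ev_scalar_mx subrr. Qed.

(* [flu s X] is the fluctuation of the observable [X] at site [s]; every product in [quad]
   is centered at both of its sites. *)
Definition flu s X : 'M[C]_(NT d T) := loc s (cen s X).

Definition quad s t : 'M[C]_(NT d T) :=
  \sum_(p : 'I_d * 'I_d)
    flu s (delta_mx p.1 p.2) *m flu t (delta_mx p.2 p.1).

Lemma quadC s t : s != t -> quad t s = quad s t.
Proof.
move=> st; rewrite [RHS]reindex_swap; apply: eq_bigr => p _ /=.
by rewrite [RHS]locC.
Qed.

Lemma loc_flu s X : loc s X = flu s X + (ev (rho s) X)%:M.
Proof. by rewrite /flu /cen raddfB /= loc_scalar subrK. Qed.

Lemma ev_delta t i j : ev (rho t) (delta_mx i j) = rho t j i.
Proof.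
rewrite /ev /mxtrace (bigD1 i) //= big1 ?addr0 => [|k ki]; rewrite mxE.
  rewrite (bigD1 j) //= mxE !eqxx mul1r big1 ?addr0 // => l lj.
  by rewrite mxE (negbTE lj) andbF mul0r.
by rewrite big1 // => l _; rewrite mxE (negbTE ki) mul0r.
Qed.

(** Each matrix unit is split into its fluctuation and its mean. The mean of a matrix unit is the
    transposed entry of the state, so the mixed terms resum to the other site's state. *)
Lemma swap_decomp s t :
  swap s t = quad s t + (flu s (rho t) + flu t (rho s))
             + (ev (rho t) (rho s))%:M.
Proof.
have sumd X : X = \sum_(p : 'I_d * 'I_d) X p.1 p.2 *: delta_mx p.1 p.2.
  by rewrite {1}[X]matrix_sum_delta pair_bigA.
have sumd' X : X = \sum_(p : 'I_d * 'I_d) X p.2 p.1 *: delta_mx p.2 p.1.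
  by rewrite {1}[X]sumd reindex_swap.
have -> : flu s (rho t)
    = \sum_(p : 'I_d * 'I_d) rho t p.1 p.2 *: flu s (delta_mx p.1 p.2).
  rewrite {1}[rho t]sumd /flu !linear_sum.
  by apply: eq_bigr => p _; rewrite !linearZ.
have -> : flu t (rho s)
    = \sum_(p : 'I_d * 'I_d) rho s p.2 p.1 *: flu t (delta_mx p.2 p.1).
  rewrite {1}[rho s]sumd' /flu !linear_sum.
  by apply: eq_bigr => p _; rewrite !linearZ.
have -> : ev (rho t) (rho s)
    = \sum_(p : 'I_d * 'I_d) rho s p.2 p.1 * rho t p.1 p.2.
  rewrite {1}[rho s]sumd' linear_sum.
  by apply: eq_bigr => p _; rewrite linearZ /= ev_delta.
rewrite raddf_sum /= -!big_split; apply: eq_bigr => p _ /=.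
rewrite (loc_flu s) (loc_flu t) !ev_delta.
rewrite mulmxDl !mulmxDr -scalar_mxM mul_scalar_mx mul_mx_scalar.
by rewrite [LHS]addrA [X in _ = X + _]addrA.
Qed.

Lemma ev_flu_flu s t X Y : s != t -> E (flu s X *m flu t Y) = 0.
Proof.
move=> st; rewrite loc_mul2; apply: (@ev_tensor_eq0 _ s).
by rewrite site_same site_diff // mulmx1 ev_cen.
Qed.

Lemma ev_quad s t : s != t -> E (quad s t) = 0.
Proof. by move=> st; rewrite linear_sum big1 // => p _; apply: ev_flu_flu. Qed.

(** The site [r] meets at most one of [s] and [t]; the other one carries a lone centered factor. *)
Lemma ev_flu_quad r s t X : s != t -> E (flu r X *m quad s t) = 0.
Proof.
move=> st; rewrite mulmx_sumr linear_sum big1 // => p _ /=; rewrite loc_mul3.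
have [rs|rs] := eqVneq r s.
  apply: (@ev_tensor_eq0 _ t).
  by rewrite site_same !site_diff ?rs 1?eq_sym // !mul1mx ev_cen.
apply: (@ev_tensor_eq0 _ s).
by rewrite site_same (site_diff _ st) site_diff 1?eq_sym // mul1mx mulmx1 ev_cen.
Qed.

Lemma ev_quad_flu r s t X : s != t -> E (quad s t *m flu r X) = 0.
Proof.
move=> st; rewrite mulmx_suml linear_sum big1 // => p _ /=.
rewrite -mulmxA loc_mul3.
have [rs|rs] := eqVneq r s.
  apply: (@ev_tensor_eq0 _ t).
  by rewrite site_same !site_diff ?rs 1?eq_sym // mul1mx mulmx1 ev_cen.
apply: (@ev_tensor_eq0 _ s).
by rewrite site_same (site_diff _ st) site_diff 1?eq_sym // !mulmx1 ev_cen.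
Qed.

Lemma ev_quad_quadl s t s' t' : s != t -> s != s' -> s != t' ->
  E (quad s t *m quad s' t') = 0.
Proof.
move=> st ss st'; rewrite mulmx_suml linear_sum big1 // => p _ /=.
rewrite mulmx_sumr linear_sum big1 // => q _ /=; rewrite -mulmxA loc_mul4.
apply: (@ev_tensor_eq0 _ s).
by rewrite site_same !site_diff // !mulmx1 ev_cen.
Qed.

(** Two different unordered pairs leave some site of the first untouched by the second, and that
    site has mean zero. When it is [t], symmetry of [quad] moves it to the front. *)
Lemma ev_quad_quad s t s' t' : s != t -> s' != t' ->
  (s', t') != (s, t) -> (s', t') != (t, s) -> E (quad s t *m quad s' t') = 0.
Proof.
move=> st st'; rewrite !xpair_eqE.
have [/eqP ss|ss] := boolP (s == s'); have [/eqP tt|tt] := boolP (s == t').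
- by move: st'; rewrite -ss -tt eqxx.
- rewrite -ss eqxx /= (eq_sym t' t) => ne _.
  by rewrite -(quadC st) ev_quad_quadl // eq_sym.
- rewrite -tt eqxx andbT (eq_sym s' t) => _ ne.
  by rewrite -(quadC st) ev_quad_quadl // eq_sym.
- by move=> _ _; rewrite ev_quad_quadl.
Qed.

Lemma hermitian_cen s X : Defs.hermitian X -> Defs.hermitian (cen s X).
Proof.
move=> hX; rewrite /Defs.hermitian adjmxB adjmx_scalar ev_real ?hX //.
by have [[]] := rho_density s.
Qed.

Lemma hermitian_rho s : Defs.hermitian (rho s).
Proof. by have [[]] := rho_density s. Qed.

Lemma hermitian_flu s X : Defs.hermitian X -> Defs.hermitian (flu s X).
Proof. by move=> hX; rewrite /Defs.hermitian adjmx_loc hermitian_cen. Qed.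

(* [quad s t] is an orthogonal projection of [swap s t], whose square is the identity. *)
Lemma ev_quad_sqr_le1 s t : s != t -> E (quad s t *m quad s t) <= 1.
Proof.
move=> st; have [psd_rho tr_rho] := density_tensor rho_density.
pose Z : 'M[C]_(NT d T) := flu s (rho t) + flu t (rho s) + (ev (rho t) (rho s))%:M.
have hZ : Defs.hermitian Z.
  apply: hermitianD.
    by apply: hermitianD; apply/hermitian_flu/hermitian_rho.
  by apply/hermitian_scalar/CrealP/ev_real; apply: hermitian_rho.
have <- : E (swap s t *m swap s t) = 1 by rewrite swap_sqr // /ev mul1mx.
rewrite swap_decomp -addrA; apply: ev_sqrD_ge => //.
  by apply: ev_mulr_sum_eq0; [exact: ev_quad_flu..|exact: ev_quad].
by apply: ev_mull_sum_eq0; [exact: ev_flu_quad..|exact: ev_quad].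
Qed.

(** A variance is unchanged by a scalar shift and is at most the second moment. The free shift [c]
    later removes the maximally mixed part of the local operator. *)
Lemma ev_flu_sqr_le s X (c : C) : c \is Num.real -> Defs.hermitian X ->
  E (flu s X *m flu s X) <= ev (rho s) ((X - c%:M) *m (X - c%:M)).
Proof.
move=> cr hX; rewrite locM ev_loc; set Y := X - c%:M.
have hY : Defs.hermitian Y.
  by rewrite /Defs.hermitian adjmxB hX adjmx_scalar (CrealP cr).
have -> : cen s X = cen s Y.
  by rewrite /Y linearB /= [cen s c%:M]/cen ev_scalar_mx subrr subr0.
rewrite /cen ev_sqr_centered ?ev1 // gerBl.
have/CrealP := ev_real (hermitian_rho s) hY.
by rewrite -realEsqr.
Qed.

(** * Variance of the summed statistic *)

Definition pair_stat : 'M[C]_(NT d T) :=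
  \sum_(p : 'I_T * 'I_T | p.1 != p.2) swap p.1 p.2.

Definition pair_mean : C :=
  \sum_(p : 'I_T * 'I_T | p.1 != p.2) ev (rho p.2) (rho p.1).

Definition others s : 'M[C]_d := \sum_(t | t != s) rho t.

(** A site occurs as first and as second entry of ordered pairs; exchanging the entries shows that
    both linear contributions agree, hence the factor 2. *)
Lemma pair_stat_decomp : pair_stat - pair_mean%:M =
  \sum_(p : 'I_T * 'I_T | p.1 != p.2) quad p.1 p.2
  + 2%:R *: \sum_s flu s (others s).
Proof.
rewrite /pair_stat /pair_mean raddf_sum -sumrB.
under eq_bigr do rewrite swap_decomp addrK.
rewrite big_split /=; congr (_ + _).
rewrite big_split /=.
have e : \sum_(p : 'I_T * 'I_T | p.1 != p.2) flu p.1 (rho p.2)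
    = \sum_s flu s (others s).
  rewrite -(pair_big_dep xpredT (fun s t => s != t) (fun s t => flu s (rho t))) /=.
  apply: eq_bigr => s _; rewrite /others /flu !linear_sum.
  by apply: eq_bigl => t; rewrite eq_sym.
rewrite [X in _ + X](reindex (fun p : 'I_T * 'I_T => (p.2, p.1))) /=; last first.
  by exists (fun p => (p.2, p.1)) => [[]|[]].
under [X in _ + X]eq_bigl do rewrite eq_sym.
by rewrite e scaler_nat mulr2n.
Qed.

Lemma ev_pair_stat_var_le (c : C) : c \is Num.real ->
  E ((pair_stat - pair_mean%:M) *m (pair_stat - pair_mean%:M)) <=
  2%:R * T%:R ^+ 2
  + 4%:R * \sum_s ev (rho s) ((others s - c%:M) *m (others s - c%:M)).
Proof.
move=> cr; rewrite pair_stat_decomp ev_sqrD_orthogonal; first last.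
- by apply: ev_mul_sum_eq0 => s p _ hp; apply: ev_flu_quad.
- by apply: ev_mul_sum_eq0 => p s hp _; apply: ev_quad_flu.
apply: lerD.
  apply: ev_sqr_sum_pairs_le => [s t|s t|s t s' t'].
  - exact: quadC.
  - exact: ev_quad_sqr_le1.
  - exact: ev_quad_quad.
rewrite ev_sqr_sum_orthogonal; last by move=> s t; apply: ev_flu_flu.
rewrite -natrX ler_pM2l ?ltr0n //; apply: ler_sum => s _.
apply: ev_flu_sqr_le => //; rewrite /Defs.hermitian adjmx_sum.
by apply: eq_bigr => t _; apply: hermitian_rho.
Qed.

End Moments.
End Swap.

Lemma hermitian_pair_stat d T : Defs.hermitian (pair_stat d T).
Proof.
rewrite /Defs.hermitian adjmx_sum; apply: eq_bigr => p hp.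
exact: adjmx_swap.
Qed.

(** By the parallelogram identity the gap between the two sides is the second moment of [A + B]. *)
Lemma ev_sqrB_le n (sigma A B : 'M[C]_n) :
  psd sigma -> Defs.hermitian A -> Defs.hermitian B ->
  ev sigma ((A - B) *m (A - B))
    <= 2%:R * ev sigma (A *m A) + 2%:R * ev sigma (B *m B).
Proof.
move=> ps hA hB; rewrite -subr_ge0.
have : 0 <= ev sigma ((A + B) *m (A + B)).
  by apply: ev_sqr_ge0 => //; apply: hermitianD.
congr (0 <= _).
have e (X : 'M[C]_n) : ev sigma ((A + X) *m (A + X)) = ev sigma (A *m A)
    + ev sigma (A *m X) + (ev sigma (X *m A) + ev sigma (X *m X)).
  exact: ev_sqrD.
rewrite !e mulmxN mulNmx mulNmx mulmxN opprK 2!(raddfN (ev sigma)) /=.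
by move: (ev _ _) (ev _ _) (ev _ _) (ev _ _) => a b c f; ring.
Qed.

Lemma mxtrace_sqr_sub_scalar n (A : 'M[C]_n) (c : C) :
  \tr ((A - c%:M) *m (A - c%:M))
  = \tr (A *m A) - 2%:R * c * \tr A + c ^+ 2 * n%:R.
Proof.
rewrite mulmxBl 2!mulmxBr -scalar_mxM mul_scalar_mx mul_mx_scalar.
rewrite 3!(raddfB (@mxtrace _ n)) /= !mxtraceZ mxtrace_scalar -mulr_natr; ring.
Qed.

(** * Bias and variance *)

Section Average.
Variables (d T : nat) (rho : 'I_T -> 'M[C]_d).
Hypotheses (d_gt0 : (0 < d)%N) (T_gt0 : (0 < T)%N).
Hypothesis rho_density : forall t, density (rho t).

Local Notation Delta := (rho_avg rho - maxmixed d).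
Local Notation purity := (\sum_s ev (rho s) (rho s)).

Let d_neq0 : d%:R != 0 :> C. Proof. by rewrite pnatr_eq0 -lt0n. Qed.
Let T_neq0 : T%:R != 0 :> C. Proof. by rewrite pnatr_eq0 -lt0n. Qed.

Lemma scale_rho_avg : T%:R *: rho_avg rho = \sum_t rho t.
Proof. by rewrite /rho_avg scalerA divff // scale1r. Qed.

Lemma hermitian_Delta : Defs.hermitian Delta.
Proof.
rewrite /Defs.hermitian adjmxB !adjmxZ adjmx1 adjmx_sum !fmorphV !rmorph_nat.
congr (_ *: _ - _); apply: eq_bigr => t _; exact: hermitian_rho.
Qed.

Lemma DHS2_ge0 : 0 <= DHS2 (rho_avg rho) (maxmixed d).
Proof.
rewrite /DHS2; have := hermitian_Delta; move: Delta => D hD.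
by rewrite -{2}hD; apply: sumr_ge0 => i _; apply: adjmx_mul_diag_ge0.
Qed.

Lemma DHS2E :
  DHS2 (rho_avg rho) (maxmixed d)
  = \tr (rho_avg rho *m rho_avg rho) - (d%:R)^-1.
Proof.
have tra : \tr (rho_avg rho) = 1.
  rewrite /rho_avg mxtraceZ raddf_sum /=.
  under eq_bigr do rewrite (rho_density _).2.
  by rewrite sumr_const card_ord -[1 *+ T]/(T%:R) mulVf.
rewrite /DHS2 /maxmixed scalemx1 mxtrace_sqr_sub_scalar tra; field.
exact: d_neq0.
Qed.

(** The double sum over all pairs is [T ^ 2] times the purity of the average; dropping the diagonal
    subtracts the individual purities, which is the bias. *)
Lemma pair_meanE :
  pair_mean rho = T%:R ^+ 2 * (DHS2 (rho_avg rho) (maxmixed d) + (d%:R)^-1)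
                  - purity.
Proof.
rewrite DHS2E subrK.
have -> : T%:R ^+ 2 * \tr (rho_avg rho *m rho_avg rho)
    = \sum_s \sum_t ev (rho t) (rho s).
  rewrite expr2 -mulrA -mxtraceZ -mxtraceZ scalemxAl scalemxAr scale_rho_avg.
  rewrite mulmx_suml raddf_sum; apply: eq_bigr => s _ /=.
  by rewrite mulmx_sumr raddf_sum.
rewrite -sumrB /pair_mean.
rewrite -(pair_big_dep xpredT (fun s t => s != t) (fun s t => ev (rho t) (rho s))) /=.
apply: eq_bigr => s _; rewrite [in RHS](bigD1 s) //= [in RHS]addrC addrK.
by apply: eq_bigl => t; rewrite eq_sym.
Qed.

Lemma ev_self_le1 s : ev (rho s) (rho s) <= 1.
Proof.
have [ps tr1] := rho_density s.
have := mxtrace_psd_mul_ge0 ps (density_le1 (rho_density s)).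
by rewrite mulmxBr mulmx1 raddfB /= tr1 subr_ge0.
Qed.

Lemma purity_ge0 : 0 <= purity.
Proof.
apply: sumr_ge0 => s _.
by apply: mxtrace_psd_mul_ge0; have [] := rho_density s.
Qed.

Lemma purity_le : purity <= T%:R.
Proof.
rewrite -[T in T%:R]card_ord -sum1_card natr_sum.
by apply: ler_sum => s _; apply: ev_self_le1.
Qed.

Lemma othersE s : others rho s - (T%:R / d%:R)%:M = T%:R *: Delta - rho s.
Proof.
rewrite scalerBr scale_rho_avg /others [in RHS](bigD1 s) //= addrAC [rho s + _]addrC addrK.
by rewrite scalerA scalemx1.
Qed.

(** After the shift by [T / d] the operator is [T] times Delta minus [rho s]. The two squares are
    separated, and [rho s <= 1] replaces each expectation by a plain trace, which introduces no
    factor of [d]. *)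
Lemma ev_others_le s :
  ev (rho s) ((others rho s - (T%:R / d%:R)%:M) *m (others rho s - (T%:R / d%:R)%:M))
  <= 2%:R * T%:R ^+ 2 * DHS2 (rho_avg rho) (maxmixed d) + 2%:R.
Proof.
have hr := hermitian_rho rho_density s.
rewrite othersE; apply: le_trans (ev_sqrB_le _ _ _) _ => //.
- by have [] := rho_density s.
- by rewrite /Defs.hermitian adjmxZ rmorph_nat hermitian_Delta.
apply: lerD.
  rewrite -mulrA ler_pM2l ?ltr0n // -scalemxAl -scalemxAr scalerA linearZ /= expr2.
  rewrite ler_wpM2l ?mulr_ge0 ?ler0n //.
  have := mxtrace_gram_density_le Delta (rho_density s).
  by rewrite hermitian_Delta.
rewrite -[leRHS]mulr1 ler_pM2l ?ltr0n //.
apply: le_trans (ev_self_le1 s).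
have := mxtrace_gram_density_le (rho s) (rho_density s).
by rewrite hr.
Qed.

Lemma pair_stat_var_le :
  ev (tensor_states rho) ((pair_stat d T - (pair_mean rho)%:M)
                          *m (pair_stat d T - (pair_mean rho)%:M))
  <= 10%:R * T%:R ^+ 2 + 8%:R * T%:R ^+ 3 * DHS2 (rho_avg rho) (maxmixed d).
Proof.
have cr : (T%:R / d%:R : C) \is Num.real by rewrite rpred_div ?realn.
apply: le_trans (ev_pair_stat_var_le rho_density cr) _.
set D := DHS2 _ _.
apply: (@le_trans _ _ (2%:R * T%:R ^+ 2
    + 4%:R * \sum_(s < T) (2%:R * T%:R ^+ 2 * D + 2%:R))).
  rewrite lerD2l ler_pM2l ?ltr0n //; apply: ler_sum => s _.
  exact: ev_others_le.
rewrite sumr_const card_ord -(mulr_natr (_ + _)) -subr_ge0.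
(* The remainder [8 * T] is absorbed into [8 * T ^ 2], which gives the coefficient 10. *)
have -> : 10%:R * T%:R ^+ 2 + 8%:R * T%:R ^+ 3 * D
    - (2%:R * T%:R ^+ 2 + 4%:R * ((2%:R * T%:R ^+ 2 * D + 2%:R) * T%:R))
    = 8%:R * (T%:R * (T%:R - 1)) :> C by ring.
by rewrite !mulr_ge0 ?ler0n // subr_ge0 ler1n.
Qed.

End Average.

(** * Constants and the final test *)

(* In both cases the mean is at least [4/1000 * n^2 * b] away from the threshold, where [b] is
   [theta] if accepting is correct and the actual distance [a] otherwise. *)
Lemma chebyshev_small (n a b theta : Rdefinitions.R) :
  0 < n -> 100 ^+ 4 <= n * theta -> 0 <= a -> a <= b -> theta <= b ->
  (10 * n ^+ 2 + 8 * n ^+ 3 * a) / (n ^+ 2 * (4 / 1000 * b)) ^+ 2 <= 1 / 100.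
Proof.
move=> n0 hn a0 ab tb.
have hb : 100 ^+ 4 <= n * b by apply: le_trans hn _; rewrite ler_pM2l.
have hb' : n * a <= n * b by rewrite ler_pM2l.
have nb0 : 0 < n * b by apply: lt_le_trans hb; rewrite exprn_gt0 // ltr0n.
have b0 : 0 < b by rewrite -(pmulr_rgt0 _ n0).
(* Once [n ^ 2] is cancelled, the right side is 1.6e-7 times [(n * b) ^ 2], hence at least
   [16 * (n * b)], which exceeds [10 + 8 * (n * a)]. *)
have sq : 100 ^+ 4 * (n * b) <= (n * b) ^+ 2.
  by rewrite expr2 ler_wpM2r // ltW.
rewrite ler_pdivrMr; last by rewrite exprn_gt0 // !mulr_gt0 ?exprn_gt0 ?invr_gt0 ?ltr0n.
have -> : 10 * n ^+ 2 + 8 * n ^+ 3 * a = n ^+ 2 * (10 + 8 * (n * a)) by ring.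
have -> : 1 / 100 * (n ^+ 2 * (4 / 1000 * b)) ^+ 2
    = n ^+ 2 * (1 / 100 * (4 / 1000) ^+ 2 * (n * b) ^+ 2) by field.
rewrite ler_pM2l ?exprn_gt0 //; move: sq hb hb' nb0.
by move: (n * b) (n * a) => u w; lra.
Qed.

Lemma ge0_real_complex (z : C) : 0 <= z ->
  exists2 x : Rdefinitions.R, 0 <= x & z = (x%:C)%C.
Proof.
move=> z0; exists (complex.Re z); last by rewrite RRe_real // ger0_real.
by move: z0; rewrite lecE => /andP[].
Qed.

Theorem theorem7p1 :
  exists K : Rdefinitions.R, 0 < K /\
  forall (d T : nat) (theta : Rdefinitions.R),
    (1 <= d)%N -> 0 <= theta -> K <= T%:R * theta ->
    exists M : 'M[C]_(NT d T),
      accept_effect M /\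
      forall rho : 'I_T -> 'M[C]_d,
        (forall t, density (rho t)) ->
        (DHS2 (rho_avg rho) (maxmixed d) <= (((99 / 100) * theta)%:C)%C ->
           (99 / 100) <= accept_prob M (tensor_states rho)) /\
        ((theta%:C)%C < DHS2 (rho_avg rho) (maxmixed d) ->
           accept_prob M (tensor_states rho) <= (1 / 100)).
Proof.
exists (100 ^+ 4); split; first by rewrite exprn_gt0 // ltr0n.
move=> d T theta d_gt0 theta_ge0 hK.
have K_gt0 : 0 < 100 ^+ 4 :> Rdefinitions.R by rewrite exprn_gt0 // ltr0n.
(* The bound on [T * theta] excludes both [T = 0] and [theta = 0]. *)
have T_gt0 : (0 < T)%N.
  by case: T hK => // hK; move: (lt_le_trans K_gt0 hK); rewrite mul0r ltxx.
pose n : Rdefinitions.R := T%:R.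
have n_gt0 : 0 < n by rewrite ltr0n.
have theta_gt0 : 0 < theta.
  by rewrite -(pmulr_rgt0 _ n_gt0); apply: lt_le_trans hK.
(* The threshold sits midway between the mean levels for [0.99 * theta] and [theta], before the bias
   is taken into account. *)
have [M [effM testM]] := threshold_test
  (n ^+ 2 * ((d%:R)^-1 + 995 / 1000 * theta)) (@hermitian_pair_stat d T).
exists M; split=> // rho rho_density.
have [D D_ge0 eD] := ge0_real_complex (DHS2_ge0 rho_density).
have [b b_ge0 eb] := ge0_real_complex (purity_ge0 rho_density).
have b_le : b <= n.
  by have := purity_le rho_density; rewrite eb -(rmorph_nat (real_complex _)) lecR.
have em : pair_mean rho = ((n ^+ 2 * (D + (d%:R)^-1) - b)%:C)%C.
  rewrite pair_meanE // eb eD rmorphB rmorphM rmorphXn rmorphD fmorphV /=.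
  by rewrite !rmorph_nat.
have var : ev (tensor_states rho) ((pair_stat d T - (pair_mean rho)%:M)
                          *m (pair_stat d T - (pair_mean rho)%:M))
    <= ((10 * n ^+ 2 + 8 * n ^+ 3 * D)%:C)%C.
  apply: le_trans (pair_stat_var_le T_gt0 rho_density) _.
  by rewrite eD rmorphD (rmorphM _ 10) (rmorphM _ _ D) (rmorphM _ 8) 2!rmorphXn !rmorph_nat.
have frac (p q : nat) : (p%:R / q%:R : C) = ((p%:R / q%:R)%:C)%C.
  by rewrite rmorphM fmorphV !rmorph_nat.
have sq_gt0 : 0 < n ^+ 2 by rewrite exprn_gt0.
(* The bias is at most [n], so it consumes at most 0.001 of the 0.005 margin and leaves 0.004. *)
have n_le : n <= n ^+ 2 * (1 / 1000 * theta).
  have -> : n ^+ 2 * (1 / 1000 * theta) = n * (1 / 1000 * (n * theta)) by ring.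
  rewrite ler_peMr ?ltW //; move: hK; rewrite -/n; move: (n * theta) => u; lra.
rewrite em in var.
have test delta (delta_gt0 : 0 < delta) :=
  testM _ (density_tensor rho_density) _ delta _ delta_gt0 var.
rewrite eD lecR ltcR !frac; split=> hD.
  (* Here the bias lowers the mean and so only helps acceptance. *)
  have delta_gt0 : 0 < n ^+ 2 * (4 / 1000 * theta).
    by rewrite !mulr_gt0 ?invr_gt0 ?ltr0n.
  have D_le : D <= theta by lra.
  have small := chebyshev_small n_gt0 hK D_ge0 D_le (lexx _).
  have [accept _] := test _ delta_gt0; apply: le_trans (accept _).
    by rewrite lecR; lra.
  have := ler_wpM2l (ltW sq_gt0) hD.
  have : 0 < n ^+ 2 * theta by rewrite mulr_gt0.
  by lra.
have D_gt0 : 0 < D by apply: lt_trans hD.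
(* The margin must scale with [D], since the variance bound grows with [D] beyond [theta]. It is
   available because [D - 0.996 * theta] is at least [0.004 * D] when [D] exceeds [theta]. *)
have delta_gt0 : 0 < n ^+ 2 * (4 / 1000 * D).
  by rewrite !mulr_gt0 ?invr_gt0 ?ltr0n.
have small := chebyshev_small n_gt0 hK D_ge0 (lexx _) (ltW hD).
have [_ reject] := test _ delta_gt0; apply: le_trans (reject _) _.
  have := ler_wpM2l (ltW sq_gt0) (ltW hD).
  by lra.
by rewrite [leRHS](frac 1 100) lecR.
Qed.
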